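(* There exists a strongly one-sided dense $F_\sigma$ set $F\subset\mathbb{R}$ which is not $\operatorname{lip} 1$.
   Context: For a continuous function $f:\mathbb{R}\to\mathbb{R}$, $x\in\mathbb{R}$ and $r>0$ put $M_f(x,r)=\frac{1}{r}\sup\{|f(x)-f(y)| : |x-y|\le r\}$, and define $\operatorname{lip} f(x)=\liminf_{r\to 0^+} M_f(x,r)$. A set $E\subset\mathbb{R}$ is called $\operatorname{lip} 1$ if there is a continuous function $f:\mathbb{R}\to\mathbb{R}$ such that $\operatorname{lip} f=\mathbf{1}_E$ (the characteristic function of $E$) everywhere on $\mathbb{R}$. Let $|A|$ denote the Lebesgue measure of $A$. A set $E\subset\mathbb{R}$ is strongly one-sided dense at $x$ if for every sequence of positive numbers $r_n\to 0^+$ we have $$\max\Big\{\frac{|E\cap[x-r_n,x]|}{r_n},\frac{|E\cap[x,x+r_n]|}{r_n}\Big\}\to 1.$$ The set $E$ is strongly one-sided dense (SOSD) if it is strongly one-sided dense at every point $x\in E$. *)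

(* Defs.v *)
From HB Require Import structures.
From mathcomp Require Import all_boot all_order all_algebra.
From mathcomp Require Import all_classical all_reals all_analysis.

Set Implicit Arguments.
Unset Strict Implicit.
Unset Printing Implicit Defensive.

Import Order.TTheory GRing.Theory Num.Theory.
Import numFieldNormedType.Exports.

Local Open Scope classical_set_scope.
Local Open Scope ring_scope.

(* The supremum and the lower limit are taken in [\bar R]: [lip f x] may be
   [+oo] even when [f] is continuous. *)
Definition osc_ratio (R : realType) (f : R -> R) (x r : R) : \bar R :=
  ((r^-1)%:E *
   ereal_sup [set `|f x - f y|%R%:E | y in [set y : R | (`|x - y| <= r)%R]])%E.

Definition lip (R : realType) (f : R -> R) (x : R) : \bar R :=
  limf_einf (osc_ratio f x) 0^'+.

Definition lip1_set (R : realType) (E : set R) : Prop :=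
  exists f : R -> R, continuous f /\ forall x : R, lip f x = (\1_E x)%:E.

Definition strongly_one_sided_dense_at (R : realType) (E : set R) (x : R)
    : Prop :=
  forall r : nat -> R, (forall n, 0 < r n) -> r n @[n --> \oo] --> 0 ->
    maxe (lebesgue_measure (E `&` `[(x - r n)%R, x]) * ((r n)^-1)%:E)%E
         (lebesgue_measure (E `&` `[x, (x + r n)%R]) * ((r n)^-1)%:E)%E
      @[n --> \oo] --> 1%:E.

Definition strongly_one_sided_dense (R : realType) (E : set R) : Prop :=
  forall x : R, E x -> strongly_one_sided_dense_at E x.

(* Main.v *)
(** If [lip f] is the indicator function of [F], then [f] is 1-Lipschitz, and a
point at which [M_f(x, r) >= c > 0] for all small [r] belongs to [F].

[F] is obtained from the line by removing, for every [k], a finite union [W k]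
of closed intervals: a late stage of the triadic Cantor construction carried
out in the [k]-th interval of a sequence containing arbitrarily short intervals
around every point.  The measure of [W k] is so small that, by the
Hardy-Littlewood maximal inequality, its average density exceeds [d k] on some
scale only on a set [B k] with [sum_k |B k|] finite.  Removing also the null set
of points lying in infinitely many [B k] leaves an F_sigma set whose points are
all density points.

Suppose that [lip f] is the indicator function of [F] and that all points of an
interval at which [M_f(., r) >= c] for all [r < t] satisfy the stronger
[M_f(., r) >= 399/400] for [r < k].  No such point lies in [W k].  If the two outer
thirds of a short interval contain none of these points, neither does the middle
third: near such a point [f] would have slope almost 1 across an outer third,
and would then be steep at some point of it.  Going up through the stages of the
Cantor construction, every short interval of the sequence is free of such
points, up to an arbitrarily small change of [c].  Hence every point with
[M_f(., r) >= c] has arbitrarily close to it points with [M_f(., r) >= c'],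
[c' < c], where [M_f(., r) < 399/400] for some arbitrarily small [r].  Iterating
gives a nested sequence whose limit [x] satisfies [0 < lip f x < 1]. *)

Require Import Defs.
From mathcomp Require Import all_boot all_order all_algebra.
From mathcomp Require Import all_classical all_reals all_analysis.
From mathcomp Require Import borel_hierarchy measurable_realfun.
From mathcomp Require Import lra.

Import numFieldNormedType.Exports.

Set Implicit Arguments.
Unset Strict Implicit.
Unset Printing Implicit Defensive.

Import Order.TTheory GRing.Theory Num.Theory.

Local Open Scope classical_set_scope.
Local Open Scope ring_scope.

(** * The lower Lipschitz constant and slopes of continuous functions *)

Section little_lip.
Context {R : realType}.
Implicit Types (f : R -> R) (c r s t x y z : R).

(* [c <= M_f(x, r)], the supremum being replaced by a witness. *)
Definition steep f c x r := exists2 y, `|x - y| <= r & c * r <= `|f x - f y|.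

Definition steep_below f c t x := forall r, 0 < r -> r < t -> steep f c x r.

Lemma steep_belowW f c c' t x :
  c' <= c -> steep_below f c t x -> steep_below f c' t x.
Proof.
move=> cc' fx r r0 rt; have [y xy fxy] := fx _ r0 rt.
by exists y => //; apply: le_trans fxy; rewrite ler_wpM2r// ltW.
Qed.

Lemma steep_osc_ratio f c x r :
  0 < r -> steep f c x r -> (c%:E <= osc_ratio f x r)%E.
Proof.
move=> r0 [y xy fxy]; rewrite /osc_ratio.
rewrite (@le_trans _ _ ((r^-1)%:E * (`|f x - f y|)%:E)%E)//.
  by rewrite -EFinM lee_fin mulrC ler_pdivlMr.
rewrite lee_pmul2l ?lte_fin ?invr_gt0//.
by apply: ereal_sup_ubound; exists y.
Qed.

Lemma osc_ratio_le f c x r : 0 < r ->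
  (forall y, `|x - y| <= r -> `|f x - f y| <= c * r) ->
  (osc_ratio f x r <= c%:E)%E.
Proof.
move=> r0 fr; rewrite /osc_ratio.
rewrite (@le_trans _ _ ((r^-1)%:E * (c * r)%:E)%E)//.
  rewrite lee_pmul2l ?lte_fin ?invr_gt0//.
  by apply: ge_ereal_sup => _ /= [y xy <-]; rewrite lee_fin fr.
by rewrite -EFinM lee_fin mulrC mulfK// gt_eqF.
Qed.

Lemma notsteep_osc_ratio f c x r :
  0 < r -> ~ steep f c x r -> (osc_ratio f x r <= c%:E)%E.
Proof.
move=> r0 fxr; apply: osc_ratio_le => // y xy.
by rewrite leNgt; apply/negP => /ltW cf; apply: fxr; exists y.
Qed.

Lemma at_right0P (V : set R) :
  (0 : R)^'+ V <-> exists2 t : R, 0 < t & forall r, 0 < r -> r < t -> V r.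
Proof.
split=> [/nbhs_ballP[t /= t0 tV]|[t t0 tV]].
  exists t => // r r0 rt; apply: tV => //.
  by rewrite /ball/= sub0r normrN gtr0_norm.
apply/nbhs_ballP; exists t => // r; rewrite /ball/= sub0r normrN => rt r0.
by apply: tV => //; rewrite gtr0_norm in rt.
Qed.

Lemma lip_ge f c t x : 0 < t -> steep_below f c t x -> (c%:E <= lip f x)%E.
Proof.
move=> t0 fx; rewrite /lip limf_einfE; apply: le_ereal_sup_tmp.
exists (ereal_inf (osc_ratio f x @` [set r | 0 < r < t])).
  exists [set r | 0 < r < t] => //; apply/at_right0P; exists t => //= r r0 rt.
  by rewrite r0.
apply: le_ereal_inf_tmp => _ [r /= /andP[r0 rt] <-].
exact/steep_osc_ratio/fx.
Qed.

Lemma lip_gt_near f c x : (c%:E < lip f x)%E ->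
  exists2 t, 0 < t & forall r, 0 < r -> r < t -> (c%:E < osc_ratio f x r)%E.
Proof.
rewrite /lip limf_einfE => /ereal_sup_gt[_ [V /at_right0P[t t0 tV] <-] cV].
exists t => // r r0 rt; apply: lt_le_trans cV _.
by apply: ereal_inf_lbound; exists r => //; exact: tV.
Qed.

Lemma lip_gt f c x : (c%:E < lip f x)%E -> exists2 t, 0 < t & steep_below f c t x.
Proof.
move=> /lip_gt_near[t t0 ft]; exists t => // r r0 rt.
apply: contrapT => /(notsteep_osc_ratio r0).
by rewrite leNgt ft.
Qed.

Lemma lip_lt f c t x : 0 < t -> (lip f x < c%:E)%E ->
  exists2 r, 0 < r < t & forall y, `|x - y| <= r -> `|f x - f y| <= c * r.
Proof.
move=> t0 fxc; apply: contrapT => nr.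
suff : (c%:E <= lip f x)%E by rewrite leNgt fxc.
apply: (@lip_ge _ _ t) => // r r0 rt; apply: contrapT => fxr.
apply: nr; exists r; first by rewrite r0.
move=> y xy; rewrite leNgt; apply/negP => /ltW cf.
by apply: fxr; exists y.
Qed.

(** The points of [[p, q]] reached from [p] with slope at most [c] form a closed set; the step from
    its supremum keeps the slope, so it must overshoot [q], by at most [d]. *)
Lemma slope_walk f c d p q : continuous f -> 0 < d -> p <= q ->
    (forall z, p <= z <= q ->
      exists2 s, 0 < s <= d & `|f (z + s) - f z| <= c * s) ->
  exists2 t, q <= t <= q + d & `|f t - f p| <= c * (t - p).
Proof.
move=> cf d0 pq step.
pose G := [set t | p <= t <= q /\ `|f t - f p| <= c * (t - p)].
have Gp : G p by split; rewrite ?lexx ?pq// !subrr normr0 mulr0.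
have supG : has_sup G.
  by split; [exists p|exists q => t [/andP[]]].
have cg : continuous (fun t => c * (t - p) - `|f t - f p|).
  move=> t; apply: cvgB.
    by apply: cvgM; [exact: cvg_cst|apply: cvgB; [exact: cvg_id|exact: cvg_cst]].
  by apply: cvg_norm; apply: cvgB; [exact: cf|exact: cvg_cst].
have clG : closed G.
  have -> : G = `[p, q] `&` (fun t => c * (t - p) - `|f t - f p|) @^-1` [set u | 0 <= u].
    by apply/seteqP; split => t; rewrite /G/= in_itv/= subr_ge0.
  apply: closedI; first exact: itv_closed.
  by apply: closed_comp => [t _|]; [exact: cg|exact: closed_ge].
have [/andP[pT Tq] fT] : G (sup G).
  by apply: clG; apply: closure_sup; [exists p|exact: (proj2 supG)].
set T := sup G in pT Tq fT.
have [s /andP[s0 sd] fs] : exists2 s, 0 < s <= d & `|f (T + s) - f T| <= c * s.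
  by apply: step; rewrite pT.
have fTs : `|f (T + s) - f p| <= c * (T + s - p).
  have -> : f (T + s) - f p = (f (T + s) - f T) + (f T - f p) by lra.
  by apply: le_trans (ler_normD _ _) _; lra.
exists (T + s) => //; rewrite lerD// andbT leNgt; apply/negP => Tsq.
suff : T + s <= T by lra.
apply: ub_le_sup; first exact: (proj2 supG).
by split=> //; lra.
Qed.

(** Arbitrarily short steps make the overshoot of [slope_walk] negligible, by continuity at [q]. *)
Lemma slope_le f c p q : continuous f -> p <= q ->
    (forall z d, p <= z <= q -> 0 < d ->
      exists2 s, 0 < s <= d & `|f (z + s) - f z| <= c * s) ->
  `|f q - f p| <= c * (q - p).
Proof.
move=> cf pq step; rewrite -subr_ge0.
set g := fun t => c * (t - p) - `|f t - f p|.
have cg : {for q, continuous g}.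
  apply: cvgB.
    by apply: cvgM; [exact: cvg_cst|apply: cvgB; [exact: cvg_id|exact: cvg_cst]].
  by apply: cvg_norm; apply: cvgB; [exact: cf|exact: cvg_cst].
rewrite -/(g q) leNgt; apply/negP => gq.
have /nbhs_ballP[d /= d0 dg] := cg _ (lt_nbhsl gq).
have [t /andP[qt td] ft] : exists2 t, q <= t <= q + d / 2 & `|f t - f p| <= c * (t - p).
  apply: slope_walk => //; first by rewrite divr_gt0.
  by move=> z pzq; apply: step => //; rewrite divr_gt0.
have : g t < 0.
  by apply: dg; rewrite /ball/= distrC ger0_norm; lra.
by rewrite /g; lra.
Qed.

(** At every point there are arbitrarily small scales of slope barely above 1, and these serve as
    the steps of [slope_le]. *)
Lemma lip_le1_lipschitz f : continuous f -> (forall x, lip f x <= 1)%E ->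
  forall p q, `|f p - f q| <= `|p - q|.
Proof.
move=> cf f1.
have H p q : p <= q -> `|f q - f p| <= q - p.
  move=> pq; apply/ler_addgt0Pl => e e0.
  have [->|npq] := eqVneq p q; first by rewrite !subrr normr0; lra.
  have pq0 : 0 < q - p by rewrite subr_gt0 lt_neqAle npq.
  have -> : e + (q - p) = (1 + e / (q - p)) * (q - p).
    by rewrite mulrDl divfK ?gt_eqF//; lra.
  apply: slope_le => // z d _ d0.
  have [|r /andP[r0 rd] fr] := @lip_lt f (1 + e / (q - p)) d z d0.
    by apply: le_lt_trans (f1 z) _; rewrite lte_fin ltrDl divr_gt0.
  exists r; first by rewrite r0 ltW.
  by rewrite distrC fr// opprD addNKr normrN gtr0_norm.
move=> p q; have [pq|qp] := leP p q.
  by rewrite distrC (distrC p) (ger0_norm (_ : 0 <= q - p)) ?subr_ge0// H.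
by rewrite (gtr0_norm (_ : 0 < p - q)) ?subr_gt0// H// ltW.
Qed.

End little_lip.

(** * Propagation of steepness along a segment *)

Section no_steep_point.
Context {R : realType}.
Variable f : R -> R.
Hypotheses (cf : continuous f) (f1 : forall p q, `|f p - f q| <= `|p - q|).
Implicit Types c d l r s t x y z : R.

(** The centre and its witness move together, and each of the two values of [f] changes by at most
    [d]. *)
Lemma steep_shift c c' d x z r : `|x - z| <= d -> c' * r <= c * r - 2 * d ->
  steep f c x r -> steep f c' z r.
Proof.
move=> xz cc' [y xy fxy]; exists (y + (z - x)).
  by rewrite (_ : z - _ = x - y)//; lra.
have := ler_distD (f z) (f x) (f y).
have := ler_distD (f (y + (z - x))) (f z) (f y).
have := f1 x z.
have := f1 (y + (z - x)) y.
rewrite (_ : y + (z - x) - y = - (x - z)) ?normrN; last by lra.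
by lra.
Qed.

(* Along a segment issued from [x] on which [f] is almost as steep as possible,
   every scale at [z] is steep: by shifting from [x] when [s] is large compared
   to [l], along the segment when [s] is comparable to [l], and the remaining
   small scales cannot all fail since they would add up to a flat stretch. *)
Lemma steep_segment_right c1 c2 k l p t x y :
    0 < l -> x <= p <= x + 2 * l -> 40 * l < k -> c1 <= 3 / 4 -> c1 <= c2 ->
    6 * l <= (c2 - c1) * k ->
    steep_below f c2 t x -> steep_below f (399 / 400) k x ->
    x <= y <= x + 40 * l -> 399 / 400 * (40 * l) <= `|f x - f y| ->
  exists2 z, p <= z <= p + l & steep_below f c1 t z.
Proof.
move=> l0 /andP[xp px] lk c1_34 c12 lc Ec2 Ek /andP[xy yx] fxy.
(* On all of [[x, y]] the function loses at most [40 * l / 400 = l / 10] against slope 1, hence no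
   more on a subinterval. *)
have slope u v : x <= u -> u <= v -> v <= y -> (v - u) - l / 8 <= `|f v - f u|.
  move=> xu uv vy.
  have := f1 x u; rewrite (distrC x) (ger0_norm (_ : 0 <= u - x)) ?subr_ge0//.
  have := f1 v y; rewrite (distrC v) (ger0_norm (_ : 0 <= y - v)) ?subr_ge0//.
  have := ler_distD (f u) (f x) (f y).
  have := ler_distD (f v) (f u) (f y).
  by rewrite (distrC (f u) (f v)); lra.
have yl : x + 399 / 10 * l <= y.
  by have := f1 x y; rewrite (distrC x) (ger0_norm (_ : 0 <= y - x)) ?subr_ge0//; lra.
apply: contrapT => noz.
have step z : p <= z <= p + l ->
    exists2 s, 0 < s <= l / 2 & `|f (z + s) - f z| <= 3 / 4 * s.
  move=> /andP[pz zp].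
  have : ~ steep_below f c1 t z by move=> Ez; apply: noz; exists z; rewrite ?pz.
  move=> /existsNP[s /not_implyP[s0 /not_implyP[st ns]]].
  have xz : `|x - z| <= 3 * l by rewrite distrC ger0_norm; lra.
  have c1s : c1 * s <= 3 / 4 * s by rewrite ler_wpM2r// ltW.
  (* Shifting by [3 * l] costs [6 * l]. For [s >= k] the gap [c2 - c1] pays; for [30 * l <= s < k]
     the gap between 399/400 and 3/4 does. *)
  have [ks|sk] := leP k s.
    exfalso; apply: ns; apply: steep_shift xz _ (Ec2 s s0 st).
    have : (c2 - c1) * k <= (c2 - c1) * s by rewrite ler_wpM2l// subr_ge0.
    by lra.
  have [ls|sl] := leP (30 * l) s.
    by exfalso; apply: ns; apply: steep_shift xz _ (Ek s s0 sk); lra.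
  have zs : `|z - (z + s)| <= s by rewrite distrC addrC addKr gtr0_norm.
  (* For [s >= l / 2] one has [s - l / 8 >= 3 / 4 * s]. *)
  have [ls|sl'] := leP (l / 2) s.
    exfalso; apply: ns; exists (z + s) => //; rewrite distrC.
    have := @slope z (z + s); rewrite (_ : z + s - z = s); last by lra.
    move=> sz; have {}sz : s - l / 8 <= `|f (z + s) - f z| by apply: sz; lra.
    by lra.
  exists s; first by rewrite s0 ltW.
  rewrite leNgt; apply/negP => fs; apply: ns; exists (z + s) => //.
  by rewrite distrC; lra.
(* Over a length of at least [l], slope 3/4 loses at least [l / 4], more than the permitted
   [l / 8]. *)
have [u /andP[pu up] fu] : exists2 u,
    p + l <= u <= p + l + l / 2 & `|f u - f p| <= 3 / 4 * (u - p).
  by apply: slope_walk => //; lra.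
have : (u - p) - l / 8 <= `|f u - f p| by apply: slope; lra.
by lra.
Qed.

End no_steep_point.

Lemma steepN {R : realType} (f : R -> R) c x r :
  steep (f \o -%R) c (- x) r <-> steep f c x r.
Proof.
split=> -[y xy]; rewrite /= ?opprK => fxy; exists (- y); rewrite /= ?opprK //.
  by rewrite (_ : x + y = - (- x - y)) ?normrN//; lra.
by rewrite (_ : - x + y = - (x - y)) ?normrN//; lra.
Qed.

Lemma steep_belowN {R : realType} (f : R -> R) c t x :
  steep_below (f \o -%R) c t (- x) <-> steep_below f c t x.
Proof. by split=> fx r r0 rt; apply/steepN/fx. Qed.

(** * Stages of the Cantor construction contain no steep point *)

Section cantor_stage.
Context {R : realType}.
Implicit Types (W : set R) (a c k l t x z lo hi : R).

(** The witness at scale [40 * l] lies to the right or to the left of [x] and gives a point in the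
    outer third on that side; reflection handles the left. *)
Lemma steep_segment (f : R -> R) c1 c2 k l t a x :
    continuous f -> (forall p q, `|f p - f q| <= `|p - q|) ->
    0 < l -> a + l <= x <= a + 2 * l -> 40 * l < k -> c1 <= 3 / 4 -> c1 <= c2 ->
    6 * l <= (c2 - c1) * k ->
    steep_below f c2 t x -> steep_below f (399 / 400) k x ->
  exists2 z, (a <= z <= a + l) || (a + 2 * l <= z <= a + 3 * l) &
    steep_below f c1 t z.
Proof.
move=> cf f1 l0 /andP[ax xa] lk c1_34 c12 lc Ec2 Ek.
have [y xy fxy] : steep f (399 / 400) x (40 * l) by apply: Ek => //; lra.
have [yx|{}yx] := leP x y.
  move: xy; rewrite distrC ger0_norm ?subr_ge0// => xy.
  have [||z zp Ez] := @steep_segment_right R f cf f1 c1 c2 k l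
    (a + 2 * l) t x y l0 _ lk c1_34 c12 lc Ec2 Ek _ fxy.
  - by lra.
  - by lra.
  by exists z => //; apply/orP; right; lra.
have cfN : continuous (f \o -%R).
  by move=> u; apply: continuous_comp; [exact: opp_continuous|exact: cf].
have f1N p q : `|(f \o -%R) p - (f \o -%R) q| <= `|p - q|.
  by rewrite /= (le_trans (f1 _ _))// (_ : - p - - q = - (p - q)) ?normrN//; lra.
move: xy; rewrite gtr0_norm ?subr_gt0// => xy.
have [|||||z zp Ez] := @steep_segment_right R _ cfN f1N c1 c2 k l
  (- (a + l)) t (- x) (- y) l0 _ lk c1_34 c12 lc _ _ _ _.
- by lra.
- exact/steep_belowN.
- exact/steep_belowN.
- by lra.
- by rewrite /= !opprK.
exists (- z); last by apply/steep_belowN; rewrite opprK.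
by apply/orP; left; lra.
Qed.

(* [fills W a l]: a stage of the triadic Cantor set of [a, a + l] is contained
   in [W]; the intervals are given by their left end and their length. *)
Inductive fills W : R -> R -> Prop :=
| fills_itv a l : 0 < l -> `[a, a + l] `<=` W -> fills W a l
| fills_thirds a l : fills W a l -> fills W (a + 2 * l) l -> fills W a (3 * l).

Lemma fills_gt0 W a l : fills W a l -> 0 < l.
Proof. by elim=> // {}a {}l _ l0 _ _; lra. Qed.

Lemma fillsS W V a l : W `<=` V -> fills W a l -> fills V a l.
Proof.
move=> WV; elim=> [{}a {}l l0 alW|{}a {}l _ H1 _ H2].
  by apply: fills_itv => //; exact: subset_trans WV.
exact: fills_thirds.
Qed.

(* The tolerance [3 / k * l] pays for comparing, on the scales [r >= k], a point
   of the middle third with the points of the outer thirds. *)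
Lemma fills_not_steep_below (f : R -> R) W c k t lo hi a l :
    continuous f -> (forall p q, `|f p - f q| <= `|p - q|) ->
    0 < k -> (forall z, steep_below f c t z -> ~ W z) ->
    (forall z, lo < z < hi -> steep_below f c t z ->
      steep_below f (399 / 400) k z) ->
    fills W a l -> lo < a -> a + l < hi -> 40 * l < k ->
    c + 3 / k * l <= 3 / 4 ->
  forall z, a <= z <= a + l -> ~ steep_below f (c + 3 / k * l) t z.
Proof.
move=> cf f1 k0 cW ck; elim=> {a l} [a l l0 alW _ _ _ _ z az Ez|].
  apply: (cW z); last by apply: alW; rewrite /= in_itv.
  by apply: steep_belowW Ez; rewrite lerDl mulr_ge0 ?divr_ge0// ltW.
move=> a l fl IHl fr IHr loa ahi lk c34 z /andP[az za] Ez.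
have l0 := fills_gt0 fl.
have kl0 : 0 < 3 / k * l by rewrite mulr_gt0 ?divr_gt0.
have kl3 : 3 / k * (3 * l) = 3 * (3 / k * l) by rewrite mulrCA.
rewrite kl3 in c34 Ez.
have Ez1 : steep_below f (c + 3 / k * l) t z by apply: steep_belowW Ez; lra.
have freel u : a <= u <= a + l -> ~ steep_below f (c + 3 / k * l) t u.
  by apply: IHl; lra.
have freer u : a + 2 * l <= u <= a + 3 * l -> ~ steep_below f (c + 3 / k * l) t u.
  by move=> u23; apply: IHr; lra.
have [zl|lz] := leP z (a + l); first by apply: (freel z) => //; rewrite az.
have [zr|rz] := leP (a + 2 * l) z; first by apply: (freer z) => //; rewrite zr.
have [||||||u /orP[] ul Eu] := @steep_segment f (c + 3 / k * l)
    (c + 3 * (3 / k * l)) k l t a z cf f1 l0 _ _ _ _ _ Ez _.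
- by lra.
- by lra.
- by lra.
- by lra.
- have -> : (c + 3 * (3 / k * l) - (c + 3 / k * l)) * k = 6 * l * (k / k).
    by lra.
  by rewrite divff ?gt_eqF//; lra.
- by apply: ck; [lra|apply: steep_belowW Ez; lra].
- exact: freel Eu.
- exact: freer Eu.
Qed.

End cantor_stage.

(** * Sets whose complement is filled at all places and scales are not lip 1 *)

Section fills_not_lip1.
Context {R : realType}.
Implicit Types (F : set R) (f : R -> R) (a c k l r t x rho : R).

(** Otherwise [fills_not_steep_below] applies to a short filled interval around [x] and excludes [x]
    itself. *)
Lemma exists_less_steep_point F f c c' k rho t x :
    continuous f -> (forall p q, `|f p - f q| <= `|p - q|) ->
    (forall z, steep_below f c' t z -> F z) ->
    (forall z d, 0 < d ->
      exists a l, [/\ fills (~` F) a l, a <= z <= a + l & l < d]) ->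
    c' < c -> c <= 3 / 4 -> 0 < k -> 0 < rho -> steep_below f c t x ->
  exists z r, [/\ `|z - x| < rho, steep_below f c' t z,
    0 < r < k & ~ steep f (399 / 400) z r].
Proof.
move=> cf f1 EF fillF c'c c34 k0 rho0 Ex; apply: contrapT => noz.
have Ek z : x - rho < z < x + rho -> steep_below f c' t z ->
    steep_below f (399 / 400) k z.
  move=> zx Ez r r0 rk; apply: contrapT => nr.
  apply: noz; exists z, r; split => //; last by rewrite r0.
  by rewrite ltr_distl.
(* The bounds keep the interval within [rho] of [x], give [40 * l < k], and keep the tolerance
   [3 / k * l] below [c - c']. *)
pose d := Num.min rho (Num.min (k / 40) ((c - c') / (3 / k))).
have d0 : 0 < d.
  by rewrite !lt_min rho0 !divr_gt0// subr_gt0.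
have [a [l [fl /andP[ax xa]]]] := fillF x d d0.
rewrite !lt_min ltr_pdivlMr// ltr_pdivlMr ?divr_gt0// => /and3P[lrho lk lc].
suff : ~ steep_below f (c' + 3 / k * l) t x.
  by apply; apply: steep_belowW Ex; lra.
apply: (@fills_not_steep_below _ _ (~` F) c' k t (x - rho) (x + rho) a l); try by lra.
- exact: cf.
- exact: f1.
- by move=> z /EF Fz; apply.
- exact: Ek.
- exact: fl.
Qed.

Lemma fills_not_lip1 F : F !=set0 ->
    (forall x d, 0 < d ->
      exists a l, [/\ fills (~` F) a l, a <= x <= a + l & l < d]) ->
  ~ lip1_set F.
Proof.
move=> [x0 Fx0] fillF [f [cf lipf]].
have lip_in x : F x -> lip f x = 1%E by move=> Fx; rewrite lipf indicE mem_set.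
have f1 p q : `|f p - f q| <= `|p - q|.
  by apply: lip_le1_lipschitz => // x; rewrite lipf lee_fin indicE; case: (_ \in _).
have EF c t x : 0 < c -> 0 < t -> steep_below f c t x -> F x.
  move=> c0 t0 /(lip_ge t0); rewrite lipf lee_fin indicE => cF.
  apply: contrapT => nF; move: cF; rewrite memNset// => /(lt_le_trans c0).
  by rewrite ltxx.
have [t t0 Et] : exists2 t, 0 < t & steep_below f (3 / 4) t x0.
  by apply: lip_gt; rewrite lip_in// lte_fin; lra.
(* a state is a centre, a radius and a steepness in ]1/2, 3/4] *)
pose P (s : R * R * R) := [/\ 0 < s.1.2, 1 / 2 < s.2 <= 3 / 4
  & steep_below f s.2 t s.1.1].
pose S := {s | P s}.
pose x_ (s : S) := (sval s).1.1.
pose rho_ (s : S) := (sval s).1.2.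
have S0 : S.
  by exists (x0, 1, 3 / 4); split; [exact: ltr01|rewrite /=; lra|exact: Et].
(* Steepness fails on a whole neighbourhood of the new centre, so that the failure passes to the
   limit. *)
pose next (s s' : S) := [/\ `|x_ s' - x_ s| < rho_ s, 2 * rho_ s' <= rho_ s
  & exists2 r, 0 < r < rho_ s & forall z, `|z - x_ s'| <= 2 * rho_ s' ->
    ~ steep f (799 / 800) z r].
have nextP s : {s' | next s s'}.
  apply: cid; have [rho0 /andP[c12 c34] Ex] := svalP s.
  set c := (sval s).2 in c12 c34 Ex; set rho := (sval s).1.2 in rho0.
  set x := (sval s).1.1 in Ex.
  (* Taking the midpoint with 1/2 keeps the steepness above 1/2 forever. *)
  pose c' := (c + 1 / 2) / 2.
  have c'0 : 0 < c' by rewrite /c'; lra.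
  have [|||z [r [zx Ez /andP[r0 rrho] nr]]] := @exists_less_steep_point F f
    c c' rho rho t x cf f1 (fun z => EF c' t z c'0 t0) fillF _ c34 _ _ Ex.
  - by rewrite /c'; lra.
  - by [].
  - by [].
  have [rho' [rho'0 rho'r rho'_small]] : exists rho' : R,
      [/\ 0 < rho', 2 * rho' <= r & 799 / 800 * r - 2 * (2 * rho') >= 399 / 400 * r].
    (* A shift by [2 * rho'] then costs [r / 800], exactly the gap between 799/800 and 399/400. *)
    by exists (r / 3200); split; lra.
  have Sz : P (z, rho', c') by split; [exact: rho'0|rewrite /= /c'; lra|exact: Ez].
  exists (exist P _ Sz); split; [exact: zx|exact: le_trans (ltW rrho)|].
  exists r; first by rewrite r0.
  by move=> u uz nu; apply: nr; exact: (steep_shift f1 uz rho'_small nu).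
have [s [_ nexts]] := dependent_choice nextP S0.
have rho0 n : 0 < rho_ (s n).
  by rewrite /rho_; case: (sval (s n)) (svalP (s n)) => -[? ?] ? [].
have steps n : x_ (s n) - 2 * rho_ (s n) <= x_ (s n.+1) - 2 * rho_ (s n.+1) /\
   x_ (s n.+1) + 2 * rho_ (s n.+1) <= x_ (s n) + 2 * rho_ (s n).
  by have [+ ? _] := nexts n; rewrite ltr_distl => /andP[? ?]; split; lra.
(* The intervals [[u n, v n]] are nested, and [y] will be a common point. *)
pose u n := x_ (s n) - 2 * rho_ (s n).
pose v n := x_ (s n) + 2 * rho_ (s n).
have undecr : {homo u : m n / (m <= n)%N >-> m <= n}.
  by apply/nondecreasing_seqP => n; exact: (steps n).1.
have vnincr : {homo v : m n / (m <= n)%N >-> n <= m}.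
  by apply/nonincreasing_seqP => n; exact: (steps n).2.
have uv m n : u m <= v n.
  apply: (@le_trans _ _ (u (maxn m n))); first by apply: undecr; rewrite leq_maxl.
  apply: (@le_trans _ _ (v (maxn m n))); last by apply: vnincr; rewrite leq_maxr.
  by rewrite /u /v; have := rho0 (maxn m n); lra.
pose y := sup (range u).
have uy n : u n <= y.
  by apply: ub_le_sup; [exists (v 0) => _ [m _ <-]; exact: uv|exists n].
have yv n : y <= v n.
  by apply: ge_sup; [exists (u 0), 0|move=> _ [m _ <-]; exact: uv].
have yx n : `|y - x_ (s n)| <= 2 * rho_ (s n).
  by rewrite ler_distl; have := uy n; have := yv n; rewrite /u/v; lra.
have rho_small k : 0 < k -> exists n, rho_ (s n) < k.
  move=> k0.
  have rhole n : rho_ (s n) <= rho_ (s 0) / 2 ^+ n.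
    elim: n => [|n IH]; first by rewrite expr0 divr1.
    have [_ + _] := nexts n.
    by rewrite exprS invfM mulrCA mulrA -/(_ / _); lra.
  have [n kn] : exists n : nat, rho_ (s 0) / k < n%:R.
    by exists (Num.truncn (rho_ (s 0) / k)).+1; exact: truncnS_gt.
  exists n; apply: (le_lt_trans (rhole n)).
  rewrite ltr_pdivrMr ?exprn_gt0// mulrC -ltr_pdivrMr//.
  apply: (lt_le_trans kn); rewrite -natrX ler_nat; exact/ltnW/ltn_expl.
(* Shifting from a centre within [r / 8] costs at most [r / 4] of the increment [r / 2]. *)
have Fy : F y.
  apply: (EF (1 / 4) t) => // r r0 rt.
  have [n rhor] : exists n, rho_ (s n) < r / 16 by apply: rho_small; lra.
  have [_ /andP[c12 _] /(_ r r0 rt) Er] := svalP (s n).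
  apply: (steep_shift f1 _ _ Er); first by rewrite distrC; exact: yx.
  have : 1 / 2 * r <= (sval (s n)).2 * r by rewrite ler_wpM2r// ltW.
  by lra.
(* Membership in [F] forces steepness 799/800 at all small scales, against [next]. *)
have [k k0 Ek] : exists2 k, 0 < k & steep_below f (799 / 800) k y.
  by apply: lip_gt; rewrite lip_in// lte_fin; lra.
have [n rhok] := rho_small _ k0.
have [_ _ [r /andP[r0 rrho]]] := nexts n.
apply; first exact: yx.
by apply: Ek => //; exact: lt_trans rhok.
Qed.

End fills_not_lip1.

(** * Holes of small measure and their shadows *)

Section sparse_holes.
Context {R : realType}.
Local Notation mu := (@lebesgue_measure R).
Implicit Types (W G B : set R) (a d e l r x : R).

(** The [n]-th stage has measure at most [(2 / 3) ^ n * l]. *)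
Lemma fills_small a l e : 0 < l -> 0 < e ->
  exists W, [/\ closed W, fills W a l & (mu W < e%:E)%E].
Proof.
move=> l0 e0.
have stage n : forall a l, 0 < l ->
    exists W, [/\ closed W, fills W a l & (mu W <= ((2 / 3) ^+ n * l)%:E)%E].
  elim: n => [|n IH] {a l0} a {}l l0.
    exists `[a, a + l]%classic; split; first exact: itv_closed.
      exact: fills_itv.
    by rewrite lebesgue_measure_itv/= lte_fin ltrDl l0 -EFinB lee_fin expr0; lra.
  have l30 : 0 < l / 3 by rewrite divr_gt0.
  have [V [cV fV mV]] := IH a _ l30.
  have [W [cW fW mW]] := IH (a + 2 * (l / 3)) _ l30.
  exists (V `|` W); split; first exact: closedU.
    rewrite (_ : l = 3 * (l / 3)); last by lra.
    apply: fills_thirds; [apply: fillsS fV|apply: fillsS fW].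
    - by left.
    - by right.
  have := measureU2 mu (closed_measurable cV) (closed_measurable cW).
  move=> /le_trans; apply; apply: (le_trans (leeD mV mW)).
  by rewrite -EFinD lee_fin exprS; lra.
have [n ne] : exists n, (2 / 3 : R) ^+ n * l < e.
  have /cvgrPdist_lt : ((2 / 3 : R) ^+ n * l) @[n --> \oo] --> 0 * l.
    by apply: cvgM; [apply: cvg_expr; rewrite ger0_norm; lra|exact: cvg_cst].
  move=> /(_ e e0)[n _ /(_ n (leqnn n))].
  rewrite mul0r sub0r normrN => /(le_lt_trans (ler_norm _)) ?.
  by exists n.
have [W [cW fW mW]] := stage n a l l0.
by exists W; split => //; apply: le_lt_trans mW _; rewrite lte_fin.
Qed.

(** [B] is the set where the maximal function of [\1_G] exceeds [d]: open by lower semicontinuity,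
    and of measure at most [3 / d * mu G] by the maximal inequality. *)
Lemma HL_maximal_shadow G d : open G -> 0 < d -> d < 1 ->
    (mu G <= (d ^+ 2)%:E)%E ->
  exists B, [/\ open B, G `<=` B, (mu B <= (3 * d)%:E)%E &
    forall x r, ~ B x -> 0 < r -> (mu (G `&` ball x r) <= (2 * d * r)%:E)%E].
Proof.
move=> oG d0 d1 mG.
have mmG : measurable G by exact: open_measurable.
have locG : locally_integrable setT (\1_G : R -> R).
  exact: locally_integrable_indic openT mmG.
have avgE x r : 0 < r ->
    iavg (\1_G : R -> R) (ball x r) = (((r *+ 2)^-1)%:E * mu (G `&` ball x r))%E.
  move=> r0; rewrite /iavg lebesgue_measure_ball ?ltW//.
  rewrite inver mulrn_eq0/= gt_eqF//; congr (_ * _)%E.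
  rewrite -(integral_indic mu (measurable_ball x r) mmG).
  by apply: eq_integral => y _; rewrite /= ger0_norm// indicE.
exists [set x | (d%:E < HL_maximal (\1_G : R -> R) x)%E]; split.
- have /lower_semicontinuousP := lower_semicontinuous_HL_maximal locG.
  by apply.
- move=> x Gx /=.
  have /nbhs_ballP[r /= r0 rG] : nbhs x G by exact: open_nbhs_nbhs.
  apply: (@lt_le_trans _ _ 1%E); first by rewrite lte_fin.
  apply: ereal_sup_ubound; exists r; first by rewrite /= in_itv/= r0.
  rewrite avgE// (_ : G `&` _ = ball x r); last by apply/setIidPr.
  by rewrite lebesgue_measure_ball ?ltW// -EFinM mulVf// mulrn_eq0/= gt_eqF.
- apply: le_trans (maximal_inequality locG d0) _.
  have -> : (\int[mu]_(y in setT) `|(\1_G y : R)%:E| = mu G)%E.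
    rewrite -[in RHS](setIT G) -integral_indic//.
    by apply: eq_integral => y _; rewrite /= ger0_norm// indicE.
  apply: (@le_trans _ _ ((3 / d)%:E * (d ^+ 2)%:E)%E).
    by rewrite lee_pmul2l// lte_fin divr_gt0.
  by rewrite -EFinM lee_fin expr2 mulrA divfK ?gt_eqF.
- move=> x r /negP; rewrite -leNgt => HLx r0.
  have : (iavg (\1_G : R -> R) (ball x r) <= d%:E)%E.
    apply: le_trans HLx; apply: ereal_sup_ubound; exists r => //.
    by rewrite /= in_itv/= r0.
  rewrite avgE// => avgd.
  have r20 : 0 < r *+ 2 by rewrite mulrn_wgt0.
  have -> : (mu (G `&` ball x r) =
      (r *+ 2)%:E * (((r *+ 2)^-1)%:E * mu (G `&` ball x r)))%E.
    by rewrite muleA -EFinM mulfV ?gt_eqF// mul1e.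
  apply: (@le_trans _ _ ((r *+ 2)%:E * d%:E)%E).
    by rewrite lee_pmul2l.
  by rewrite -EFinM lee_fin; lra.
Qed.

Lemma fills_shadow a l d : 0 < l -> 0 < d -> d < 1 ->
  exists WB : set R * set R, [/\ closed WB.1 /\ fills WB.1 a l,
    open WB.2, WB.1 `<=` WB.2, (mu WB.2 <= (3 * d)%:E)%E &
    forall x r, ~ WB.2 x -> 0 < r ->
      (mu (WB.1 `&` `[x, (x + r)%R]) <= (4 * d * r)%:E)%E].
Proof.
move=> l0 d0 d1.
(* Half of [d ^ 2] is for [W], half for enlarging it to an open set. *)
have d20 : 0 < d ^+ 2 / 2 by rewrite divr_gt0// exprn_gt0.
have [W [cW fW mW]] := fills_small a l0 d20.
have mmW : measurable W by exact: closed_measurable.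
have [G [oG WG mGW]] := lebesgue_regularity_outer mmW (lt_trans mW (ltry _)) d20.
have mmG : measurable G by exact: open_measurable.
have mG : (mu G <= (d ^+ 2)%:E)%E.
  rewrite (measureDI mu mmG mmW) (setIidr WG).
  have -> : d ^+ 2 = d ^+ 2 / 2 + d ^+ 2 / 2 by lra.
  by rewrite EFinD leeD// ltW.
have [B [oB GB mB shadow]] := HL_maximal_shadow oG d0 d1 mG.
exists (W, B); split => //=; first exact: subset_trans GB.
(* The open ball of radius [r] misses the endpoint [x + r]; doubling the radius turns the factor 2
   into 4. *)
move=> x r nBx r0; have r20 : 0 < 2 * r by lra.
have := shadow x (2 * r) nBx r20.
rewrite (_ : 2 * d * (2 * r) = 4 * d * r); last by lra.
apply: le_trans; apply: le_measure; rewrite ?inE.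
- by apply: measurableI => //; exact: measurable_itv.
- by apply: measurableI => //; exact: measurable_ball.
- apply: setISS => // y /=; rewrite in_itv/= => /andP[xy yx].
  by rewrite /ball/= distrC ger0_norm; lra.
Qed.

Lemma intervals_sequence : exists al : nat -> R * R,
  (forall k, 0 < (al k).2) /\
  forall x d, 0 < d ->
    exists k, (al k).1 <= x <= (al k).1 + (al k).2 /\ (al k).2 < d.
Proof.
(* Nonpositive rationals and codes of no pair get the default length 1. *)
pose ratl (q : rat) : R := if 0 < ratr q :> R then ratr q else 1.
pose al k : R * R :=
  if unpickle k is Some pq then (ratr pq.1, ratl pq.2) else (0, 1).
exists al; split=> [k|x d d0].
  by rewrite /al /ratl; case: unpickle => [[p q]|]//=; case: ifPn.
have [q] : exists q : rat, ratr q \in `]0, d[ by apply: rat_in_itvoo.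
rewrite in_itv/= => /andP[q0 qd].
have [p] : exists p : rat, ratr p \in `](x - ratr q), x[.
  by apply: rat_in_itvoo; lra.
rewrite in_itv/= => /andP[qp px].
by exists (pickle (p, q)); rewrite /al pickleK/= /ratl q0; split; lra.
Qed.

End sparse_holes.

(** * Right density implies strong one-sided density *)

Section right_density.
Context {R : realType}.
Local Notation mu := (@lebesgue_measure R).
Implicit Types (F : set R) (e r rho x : R).

Lemma lebesgue_measure_segment (a b : R) : a <= b ->
  mu (`[a, b]%classic : set R) = (b - a)%:E.
Proof.
rewrite le_eqVlt lebesgue_measure_itv/= lte_fin => /predU1P[->|ab].
  by rewrite ltxx subrr.
by rewrite ab.
Qed.

(** Both ratios are at most 1, so a lower bound on the right one alone controls the maximum. *)
Lemma right_dense_strongly_one_sided_dense F x : measurable F ->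
    (forall e, 0 < e -> exists2 rho, 0 < rho & forall r, 0 < r -> r < rho ->
      (((1 - e) * r)%:E <= mu (F `&` `[x, (x + r)%R]))%E) ->
  strongly_one_sided_dense_at F x.
Proof.
move=> mF dF r r0 rcvg.
set M := fun n => maxe (mu (F `&` `[(x - r n)%R, x]) * ((r n)^-1)%:E)%E
  (mu (F `&` `[x, (x + r n)%R]) * ((r n)^-1)%:E)%E.
have ratio_le1 n a b : b - a = r n ->
    (mu (F `&` `[a, b]) * ((r n)^-1)%:E <= 1)%E.
  move=> ab; have ab' : a <= b by rewrite -subr_ge0 ab ltW.
  apply: (@le_trans _ _ ((r n)%:E * ((r n)^-1)%:E)%E); last first.
    by rewrite -EFinM mulfV// gt_eqF.
  rewrite lee_pmul2r ?lte_fin ?invr_gt0//.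
  rewrite -ab -lebesgue_measure_segment//; apply: le_measure; rewrite ?inE//.
  by apply: measurableI => //; exact: measurable_itv.
have M1 n : (M n <= 1)%E.
  by rewrite ge_max !ratio_le1//; lra.
have M0 n : (0 <= M n)%E.
  by rewrite le_max mule_ge0// lee_fin invr_ge0 ltW.
have Mfin n : M n \is a fin_num.
  by rewrite ge0_fin_numE// (le_lt_trans (M1 n))// ltry.
apply/fine_cvgP; split; first by apply: nearW => n; exact: Mfin.
apply/cvgrPdist_le => e e0.
have [rho rho0 Fr] := dF e e0.
have /cvgrPdist_lt/(_ _ rho0) := rcvg.
apply: filterS => n; rewrite sub0r normrN gtr0_norm// => rn.
rewrite /= ger0_norm; last by rewrite subr_ge0 -lee_fin fineK.
rewrite lerBlDr -lerBlDl -lee_fin fineK//.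
rewrite le_max; apply/orP; right.
rewrite -[1 - e](@mulfK R (r n)) ?gt_eqF// EFinM.
by rewrite lee_pmul2r ?lte_fin ?invr_gt0// Fr.
Qed.

End right_density.

(** * The complement of the holes as a dense F_sigma set *)

Section complement_of_holes.
Context {R : realType}.
Local Notation mu := (@lebesgue_measure R).
Variables (W B : nat -> set R) (d : nat -> R).
Hypotheses (cW : forall k, closed (W k)) (oB : forall k, open (B k)).
Hypothesis WB : forall k, W k `<=` B k.
Hypotheses (d0 : forall k, 0 < d k) (dsum : (\sum_(k <oo) (d k)%:E <= 1)%E).
Hypothesis mB : forall k, (mu (B k) <= (3 * d k)%:E)%E.
Hypothesis shadow : forall k x r, ~ B k x -> 0 < r ->
  (mu (W k `&` `[x, (x + r)%R]) <= (4 * d k * r)%:E)%E.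
Implicit Types (e r x : R) (i k : nat).

Definition away (A : set R) i : set R :=
  [set x | forall w, A w -> i.+1%:R^-1 <= `|x - w|].

(* The points that avoid all of the [W k] and belong to finitely many [B k];
   the sets [away] only serve to make [F] a union of closed sets. *)
Definition body i : set R :=
  \bigcap_k (~` B k `|` [set x | (k < i)%N /\ away (W k) i x]).

Definition solid : set R := \bigcup_i body i.

Lemma closed_away (A : set R) i : closed (away A i).
Proof.
have -> : away A i = \bigcap_(w in A) (fun x => `|x - w|) @^-1` [set u | i.+1%:R^-1 <= u].
  by apply/seteqP; split => x H w; exact: H.
apply: closed_bigI => w _; apply: closed_comp; last exact: closed_ge.
move=> x _; apply: cvg_norm; apply: cvgB; [exact: cvg_id|exact: cvg_cst].
Qed.

Lemma closed_body i : closed (body i).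
Proof.
apply: closed_bigI => k _; have [ki|ik] := ltnP k i.
  apply: closedU; first exact: open_closedC.
  rewrite (_ : [set _ | _] = away (W k) i); first exact: closed_away.
  by apply/seteqP; split => x /=; [case|].
rewrite (_ : _ `|` _ = ~` B k); first exact: open_closedC.
apply/seteqP; split => x; last by left.
by move=> [//|[]].
Qed.

Lemma Fsigma_solid : Fsigma solid.
Proof. by exists body => //; exact: closed_body. Qed.

Lemma measurable_solid : measurable solid.
Proof.
by apply: bigcupT_measurable => i; apply: closed_measurable; exact: closed_body.
Qed.

Lemma solid_not_hole k x : solid x -> ~ W k x.
Proof.
move=> [i _ /(_ k I)[nB /WB//|/= [_ aw] Wx]].
have := aw x Wx; rewrite subrr normr0 leNgt => /negP; apply.
by rewrite invr_gt0.
Qed.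

Lemma solid_notB x : solid x -> exists i, forall k, (i <= k)%N -> ~ B k x.
Proof.
move=> [i _ bx]; exists i => k ik; have [//|/= []] := bx k I.
by rewrite ltnNge ik.
Qed.

(** A point outside all [W k], and outside [B k] for [k >= j], has positive distance to each of the
    finitely many closed [W k] with [k < j]; a large [i] puts it into [body i]. *)
Lemma setC_solid : ~` solid `<=` lim_sup_set B `|` \bigcup_k W k.
Proof.
move=> x; apply: contraPP => /= /not_orP[nlim nW].
suff : solid x by move=> ?; apply.
have [j jB] : exists j, forall k, (j <= k)%N -> ~ B k x.
  apply: contrapT => nj; apply: nlim => j _; apply: contrapT => njk.
  by apply: nj; exists j => k jk Bx; apply: njk; exists k.
have aw k : exists i, forall i', (i <= i')%N -> away (W k) i' x.
  have : nbhs x (~` W k).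
    apply: open_nbhs_nbhs; split; first exact: closed_openC.
    by move=> Wx; apply: nW; exists k.
  move=> /nbhs_ballP[e /= e0 eW].
  exists (Num.truncn e^-1) => i' ii' w Ww; rewrite leNgt; apply/negP => xw.
  apply: (eW w) => //; rewrite /ball/=; apply: lt_trans xw _.
  rewrite invf_plt ?posrE//; apply: lt_le_trans (truncnS_gt _) _.
  by rewrite ler_nat ltnS.
have /choice[m mP] := aw.
exists (maxn j (\max_(k < j) (m k)).+1) => // k _.
have [kj|jk] := ltnP k j; last by left; exact: jB.
right; split; first by rewrite leq_max kj.
apply: mP; apply: leq_trans (leq_maxr _ _); apply: leqW.
exact: (@leq_bigmax _ (fun k : 'I_j => m k) (Ordinal kj)).
Qed.

Lemma sum_muB : (\sum_(k <oo) mu (B k) <= 3%:E)%E.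
Proof.
apply: (@le_trans _ _ (\sum_(k <oo) (3%:E * (d k)%:E))%E).
  apply: lee_nneseries => [k _ _|k _]; first exact: measure_ge0.
  by rewrite -EFinM; exact: mB.
rewrite nneseriesZl; last by move=> k _; rewrite lee_fin ltW.
apply: (@le_trans _ _ (3%:E * 1)%E); last by rewrite mule1.
by rewrite lee_pmul2l// lte_fin.
Qed.

(** This is the first Borel-Cantelli lemma. *)
Lemma lim_sup_B0 : mu (lim_sup_set B) = 0%E.
Proof.
apply: lim_sup_set_cvg0 => [k|]; first exact: open_measurable.
by apply: le_lt_trans sum_muB _; rewrite ltry.
Qed.

(** The [B k], of total measure at most 3, cannot cover an interval of length 4. *)
Lemma solid_nonempty : solid !=set0.
Proof.
apply: contrapT => /nonemptyPn solid0.
have cover : `[0, 4]%classic `<=` \bigcup_k B k.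
  move=> x _; apply: contrapT => nB.
  suff : solid x by rewrite solid0.
  by exists 0 => // k _; left => Bx; apply: nB; exists k.
have mmB k : measurable (B k) by exact: open_measurable.
have : (mu (`[0%R, 4%R]%classic : set R) <= \sum_(k <oo) mu (B k))%E.
  by apply: measure_sigma_subadditive => //; exact: measurable_itv.
rewrite lebesgue_measure_segment// subr0 leNgt => /negP; apply.
by apply: le_lt_trans sum_muB _; rewrite lte_fin ltr_nat.
Qed.

(** The finitely many closed holes of index below [N] stay away from [x]; the later ones occupy at
    most [4 * r] times a tail of the sum of the [d k], and the rest of the complement is null. *)
Lemma solid_right_dense x e : solid x -> 0 < e ->
  exists2 rho, 0 < rho & forall r, 0 < r -> r < rho ->
    (((1 - e) * r)%:E <= mu (solid `&` `[x, (x + r)%R]))%E.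
Proof.
move=> Fx e0; have [j jB] := solid_notB Fx.
have e40 : 0 < e / 4 by rewrite divr_gt0.
have [N jN dN] : exists2 N, (j <= N)%N & (\sum_(N <= k <oo) (d k)%:E <= (e / 4)%:E)%E.
  have /fine_cvgP[fin] : (\sum_(N <= k <oo) (d k)%:E)%E @[N --> \oo] --> 0%:E.
    apply: nneseries_tail_cvg; first by apply: le_lt_trans dsum _; rewrite ltry.
    by move=> k _; rewrite lee_fin ltW.
  move=> /cvgr0_norm_lt/(_ _ e40) => small.
  have [N0 _ NP] := filterI fin small.
  exists (maxn j N0); first exact: leq_maxl.
  have [Nfin Nsmall] := NP _ (leq_maxr j N0).
  by rewrite -(fineK Nfin) lee_fin (le_trans (ler_norm _))// ltW.
have [rho rho0 rhoP] : exists2 rho, 0 < rho & forall k y, (k < N)%N ->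
    `|x - y| < rho -> ~ W k y.
  have : \forall y \near x, forall k : 'I_N, ~ W k y.
    apply: (@filter_forall _ _ (fun k : 'I_N => ~` W k) (nbhs x) _) => k.
    apply: open_nbhs_nbhs; split.
      exact: closed_openC.
    exact: solid_not_hole.
  move=> /nbhs_ballP[rho /= rho0 H]; exists rho => // k y kN xy.
  exact: H xy (Ordinal kN).
exists rho => // r r0 rrho.
set I := `[x, (x + r)%R]%classic.
have mI : measurable I by exact: measurable_itv.
have mW k : measurable (W k `&` I).
  by apply: measurableI => //; exact: closed_measurable.
have mWN : measurable (\bigcup_(k in ~` `I_N) (W k `&` I)).
  by apply: bigcup_measurable.
have mlim : measurable (lim_sup_set B).
  apply: bigcapT_measurable => n; apply: bigcup_measurable => k _.
  exact: open_measurable.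
have holes : I `\` solid `<=` lim_sup_set B `|` \bigcup_(k in ~` `I_N) (W k `&` I).
  move=> y [Iy /setC_solid[|[k _ Wy]]]; first by left.
  right; exists k => //= kN; apply: (rhoP k y) => //.
  move: Iy; rewrite /I/= in_itv/= => /andP[xy yx].
  by rewrite distrC ger0_norm; lra.
have muN : (mu (\bigcup_(k in ~` `I_N) (W k `&` I)) <= (e * r)%:E)%E.
  apply: (@le_trans _ _ (\sum_(N <= k <oo) mu (W k `&` I))%E).
    exact: measure_sigma_subadditive_tail.
  apply: (@le_trans _ _ (\sum_(N <= k <oo) ((4 * r)%:E * (d k)%:E))%E).
    rewrite [leLHS]eseries_cond [leRHS]eseries_cond.
    apply: lee_nneseries => [k _ _|k /andP[_ Nk]]; first exact: measure_ge0.
    rewrite -EFinM (_ : 4 * r * d k = 4 * d k * r); last by lra.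
    by apply: shadow => //; apply: jB; exact: leq_trans jN Nk.
  rewrite nneseriesZl; last by move=> k _; rewrite lee_fin ltW.
  apply: (@le_trans _ _ ((4 * r)%:E * (e / 4)%:E)%E).
    by rewrite lee_pmul2l// lte_fin mulr_gt0.
  by rewrite -EFinM lee_fin; lra.
have muI : (mu (I `\` solid) <= (e * r)%:E)%E.
  apply: (@le_trans _ _ (mu (lim_sup_set B `|` \bigcup_(k in ~` `I_N) (W k `&` I)))).
    apply: le_measure; rewrite ?inE//.
      by apply: measurableD => //; exact: measurable_solid.
    exact: measurableU.
  apply: (@le_trans _ _ (mu (lim_sup_set B) +
      mu (\bigcup_(k in ~` `I_N) (W k `&` I)))%E); first exact: measureU2.
  by rewrite lim_sup_B0 add0e.
have rE : r%:E = (mu (I `\` solid) + mu (solid `&` I))%E.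
  transitivity (mu I); last first.
    by rewrite setIC; apply: measureDI => //; exact: measurable_solid.
  by rewrite /I lebesgue_measure_segment ?lerDl ?ltW// addrAC subrr add0r.
have : (r%:E <= (e * r)%:E + mu (solid `&` I))%E by rewrite rE leeD2r.
rewrite -leeBlDl// -EFinB.
by rewrite mulrBl mul1r.
Qed.

Lemma strongly_one_sided_dense_solid : strongly_one_sided_dense solid.
Proof.
move=> x Fx; apply: right_dense_strongly_one_sided_dense.
  exact: measurable_solid.
by move=> e; exact: solid_right_dense.
Qed.

End complement_of_holes.

(** * Construction of the set *)

Theorem corollary3p3 (R : realType) :
  exists F : set R,
    [/\ strongly_one_sided_dense F, Fsigma F & ~ lip1_set F].
Proof.
have [al [al0 alP]] := @intervals_sequence R.
pose d k : R := 1 / (2 ^ k.+1)%:R.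
have d0 k : 0 < d k by rewrite divr_gt0// ltr0n expn_gt0.
have d1 k : d k < 1.
  by rewrite ltr_pdivrMr ?ltr0n ?expn_gt0// mul1r ltr1n (leq_ltn_trans _ (ltn_expl _ _)).
have dsum : (\sum_(k <oo) (d k)%:E <= 1)%E by exact: epsilon_trick0.
have /choice[WB WBP] k := fills_shadow (al k).1 (al0 k) (d0 k) (d1 k).
pose W k := (WB k).1; pose B k := (WB k).2.
have cW k : closed (W k) by have [[]] := WBP k.
have oB k : open (B k) by have [] := WBP k.
have sWB k : W k `<=` B k by have [] := WBP k.
have mB k : (lebesgue_measure (B k) <= (3 * d k)%:E)%E by have [] := WBP k.
have shadow k x r : ~ B k x -> 0 < r ->
    (lebesgue_measure (W k `&` `[x, (x + r)%R]) <= (4 * d k * r)%:E)%E.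
  by have [_ _ _ _] := WBP k; apply.
exists (solid W B); split.
- exact: (@strongly_one_sided_dense_solid R W B d).
- exact: Fsigma_solid.
- apply: fills_not_lip1; first exact: (@solid_nonempty R W B d).
  move=> x e e0; have [k [xk ke]] := alP x e e0.
  exists (al k).1, (al k).2; split => //.
  have [[_ fW] _ _ _ _] := WBP k.
  by apply: fillsS fW => y Wy Fy; exact: solid_not_hole sWB _ _ Fy Wy.
Qed.
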